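(* Let $\mathcal{H}$ be the Schreier graph, with respect to the standard generators $x_0,x_1$, of the action of Thompson's group $F$ on the orbit of the point $p=1/2$. For $n\ge 0$ let $B(p,n)$ and $\partial B(p,n)$ be the ball and the sphere of radius $n$ centered at $p$ in the graph distance of $\mathcal{H}$, and let $g_n$ be the number of geodesic words of length $n$ for $p$. Put $\varphi=\frac{1+\sqrt5}{2}$ and $\hat\varphi=\frac{1-\sqrt5}{2}$. Then: (1) the geodesic growth function is $$\sum_{n\ge 0} g_n z^n=\frac{1}{1-2z};$$ (2) the orbit growth function is $$\sum_{n\ge 0}|\partial B(p,n)|\,z^n=\frac{1+z}{1-z-z^2};$$ (3) for all $n\ge 0$, $$|\partial B(p,n)|=\frac{\varphi^{n+2}-\hat\varphi^{\,n+2}}{\sqrt5},\qquad |B(p,n)|=\frac{\varphi^{n+3}-\varphi^2}{\sqrt5(\varphi-1)}-\frac{\hat\varphi^{\,n+3}-\hat\varphi^{\,2}}{\sqrt5(\hat\varphi-1)}.$$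
   Context: Thompson's group $F$ is the group (under composition) of all orientation-preserving piecewise linear homeomorphisms of $[0,1]$ with finitely many points of non-differentiability, all of which are dyadic rationals, and whose derivative, where it exists, is an integer power of $2$. It is generated by $x_0,x_1$, where $x_0(t)=t/2$ for $0\le t\le 1/2$, $x_0(t)=t-1/4$ for $1/2\le t\le 3/4$, $x_0(t)=2t-1$ for $3/4\le t\le 1$; and $x_1(t)=t$ for $0\le t\le 1/2$, $x_1(t)=\tfrac12+\tfrac12 x_0(2t-1)$ for $1/2\le t\le 1$. The Schreier graph $\mathcal{H}$ has as vertices the points of the $F$-orbit of $1/2$ (all dyadic rationals in $(0,1)$), and for each vertex $y$ and each $s\in\{x_0,x_1\}$ an edge labelled $s$ from $y$ to $s(y)$ (loops and multiple edges allowed; edges may be traversed in either direction, traversing backwards corresponding to $s^{-1}$). The graph distance $d$ ignores orientation; $B(p,n)=\{y: d(p,y)\le n\}$ and $\partial B(p,n)=\{y: d(p,y)=n\}$. A geodesic word of length $n$ for $p$ is a sequence $(s_1,\dots,s_n)$ with $s_i\in\{x_0,x_0^{-1},x_1,x_1^{-1}\}$ such that the points $y_0=p$, $y_i=s_i(y_{i-1})$ satisfy $d(p,y_n)=n$. Thus two geodesic paths with the same vertices but different edge labels are counted separately. *)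

(* Defs.v *)
From HB Require Import structures.
From mathcomp Require Import all_boot all_order all_algebra.
From mathcomp Require Import all_classical all_reals all_analysis.
From mathcomp Require Import finmap lra.
Set Implicit Arguments.
Unset Strict Implicit.
Unset Printing Implicit Defensive.
Import Order.TTheory GRing.Theory Num.Theory.
Import numFieldNormedType.Exports.
Local Open Scope classical_set_scope.
Local Open Scope ring_scope.

(* Formal power series R[[z]], given by their coefficient sequences.  The alias
   carries the Cauchy product, not the pointwise product of nat -> R. *)
Definition fps (R : comNzRingType) : Type := nat -> R.

Section FormalPowerSeries.
Variable R : comNzRingType.
Implicit Types a b c : fps R.

HB.instance Definition _ := GRing.Zmodule.copy (fps R) (nat -> R).

Definition fps_one : fps R := fun n => (n == 0%N)%:R.
Definition fps_mul a b : fps R := fun n => \sum_(i < n.+1) a i * b (n - i)%N.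

Let trunc n a : {poly R} := \poly_(i < n) a i.

Let fps_mul_trunc N n a b : (n < N)%N ->
  fps_mul a b n = (trunc N a * trunc N b)`_n.
Proof.
move=> nN; rewrite coefM; apply: eq_bigr => i _; rewrite !coef_poly.
by rewrite (leq_ltn_trans (leq_subr _ _) nN) (leq_ltn_trans _ nN) // -ltnS.
Qed.

Fact fps_mulC : commutative fps_mul.
Proof.
by move=> a b; apply/funext => n; rewrite !(@fps_mul_trunc n.+1) // mulrC.
Qed.

Let fps_mul3_trunc n a b c :
  fps_mul (fps_mul a b) c n = (trunc n.+1 a * trunc n.+1 b * trunc n.+1 c)`_n.
Proof.
rewrite coefM; apply: eq_bigr => i _.
by rewrite (@fps_mul_trunc n.+1) // coef_poly ltnS leq_subr.
Qed.

Fact fps_mulA : associative fps_mul.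
Proof.
move=> a b c; apply/funext => n.
by rewrite fps_mulC !fps_mul3_trunc mulrC mulrA.
Qed.

Fact fps_mul1 : left_id fps_one fps_mul.
Proof.
move=> a; apply/funext => n; rewrite /fps_mul big_ord_recl subn0 mul1r.
by rewrite big1 ?addr0 // => i _; rewrite mul0r.
Qed.

Fact fps_mulDl : left_distributive fps_mul +%R.
Proof.
move=> a b c; apply/funext => n; rewrite [RHS]/GRing.add /= /fps_mul -big_split.
by apply: eq_bigr => i _; exact: mulrDl.
Qed.

Fact fps_one_neq0 : fps_one != 0.
Proof.
by apply/eqP => /(congr1 (fun a => a 0%N)) /eqP; rewrite (negPf (oner_neq0 R)).
Qed.

HB.instance Definition _ := GRing.Zmodule_isComNzRing.Build (fps R)
  fps_mulA fps_mulC fps_mul1 fps_mulDl fps_one_neq0.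

Definition fps_unit : {pred fps R} := fun a => `[< exists b, b * a = 1 >].
Definition fps_inv a : fps R := xget a [set b | b * a = 1].

Fact fps_mulVr : {in fps_unit, left_inverse 1 fps_inv *%R}.
Proof. by move=> a /asboolP; exact: (@xgetPex _ a [set b | b * a = 1]). Qed.

Fact fps_unitPl a b : b * a = 1 -> fps_unit a.
Proof. by move=> ba1; apply/asboolP; exists b. Qed.

Fact fps_invr_out : {in [predC fps_unit], fps_inv =1 id}.
Proof.
move=> a /asboolP aN; rewrite /fps_inv; case: xgetP => // b _ ba1.
by case: aN; exists b.
Qed.

HB.instance Definition _ := GRing.ComNzRing_hasMulInverse.Build (fps R)
  fps_mulVr fps_unitPl fps_invr_out.

(* The indeterminate z. *)
Definition fpsX : fps R := fun n => (n == 1%N)%:R.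

(* genfun a is the series \sum_(n >= 0) a_n z^n. *)
Definition genfun (a : nat -> nat) : fps R := fun n => (a n)%:R.

End FormalPowerSeries.

Section ThompsonF.
Variable R : realType.
Implicit Types (f : R -> R) (t y z p : R).

Definition dyadic t : Prop := exists (m : int) (k : nat), t = m%:~R / 2 ^+ k.

(* f is affine on every subinterval of [0, 1] whose interior avoids a suitable
   finite set of breakpoints. *)
Definition piecewise_linear f : Prop :=
  exists s : seq R, forall a b, 0 <= a -> a < b -> b <= 1 ->
    (forall c, c \in s -> ~~ (a < c < b)) ->
    exists m q : R, forall t, a <= t <= b -> f t = m * t + q.

Definition nondiff f : set R := [set t | 0 < t < 1 /\ ~ derivable f t 1].

(* Only the values on [0, 1] of an element f of F matter.  The inverse of a
   continuous bijection of [0, 1] is continuous, so it is not required. *)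
Definition thompsonF : set (R -> R) := [set f : R -> R |
  [/\ set_bij `[0, 1] `[0, 1] f,
      {within `[0, 1], continuous f} &
      {in `[0, 1]%R &, {homo f : t u / t < u}}] /\
  [/\ piecewise_linear f,
      finite_set (nondiff f),
      nondiff f `<=` dyadic &
      forall t, 0 < t < 1 -> derivable f t 1 -> exists k : int, derive1 f t = 2 ^ k]].

(* The formulas for the generators are extended to all of R; on [0, 1] they are
   the usual ones. *)
Definition x0 t : R :=
  if t <= 1 / 2 then t / 2 else if t <= 3 / 4 then t - 1 / 4 else 2 * t - 1.

Definition x1 t : R :=
  if t <= 1 / 2 then t else 1 / 2 + 1 / 2 * x0 (2 * t - 1).

Definition x0inv t : R :=
  if t <= 1 / 4 then 2 * t else if t <= 1 / 2 then t + 1 / 4 else (t + 1) / 2.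

Definition x1inv t : R :=
  if t <= 1 / 2 then t else 1 / 2 + 1 / 2 * x0inv (2 * t - 1).

Lemma x0K : cancel x0 x0inv.
Proof. by move=> t; rewrite /x0 /x0inv; do ![case: ifPn]; lra. Qed.

Lemma x0invK : cancel x0inv x0.
Proof. by move=> t; rewrite /x0 /x0inv; do ![case: ifPn]; lra. Qed.

Lemma x1K : cancel x1 x1inv.
Proof. by move=> t; rewrite /x1 /x1inv /x0 /x0inv; do ![case: ifPn]; lra. Qed.

Lemma x1invK : cancel x1inv x1.
Proof. by move=> t; rewrite /x1 /x1inv /x0 /x0inv; do ![case: ifPn]; lra. Qed.

(* i = false stands for x0 and i = true for x1. *)
Definition gen (i : bool) : R -> R := if i then x1 else x0.

(* The letter (i, false) is x_i, the letter (i, true) is x_i^-1. *)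
Definition letter : Type := (bool * bool)%type.

Definition act (s : letter) : R -> R :=
  match s with
  | (false, false) => x0
  | (false, true) => x0inv
  | (true, false) => x1
  | (true, true) => x1inv
  end.

(* Vertices of the Schreier graph: the F-orbit of 1/2. *)
Definition vertex : set R := [set f (1 / 2) | f in thompsonF].

(* The edge labelled x_i from y to z. *)
Definition edge (i : bool) y z : Prop := [/\ vertex y, vertex z & z = gen i y].

Definition adjacent y z : Prop := exists i, edge i y z \/ edge i z y.

Fixpoint walk (n : nat) y z : Prop :=
  if n is m.+1 then exists2 u, adjacent y u & walk m u z
  else vertex y /\ y = z.

(* dist y z n is "d(y, z) = n"; as a relation, it needs no convention for
   vertices that no walk joins. *)
Definition dist y z (n : nat) : Prop :=
  walk n y z /\ forall m, walk m y z -> (n <= m)%N.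

Definition sphere p (n : nat) : set R := [set y | dist p y n].
Definition ball p (n : nat) : set R :=
  [set y | exists2 m, (m <= n)%N & dist p y m].

(* The first letter of a word acts first: y_i = s_i (y_(i-1)). *)
Definition endpoint p (w : seq letter) : R :=
  foldl (fun y s => act s y) p w.

Definition geodesic_word p (n : nat) (w : n.-tuple letter) : Prop :=
  dist p (endpoint p w) n.

Definition geodesic_growth p (n : nat) : nat :=
  #|[pred w : n.-tuple letter | `[< geodesic_word p w >]]|.

(* fset_set sends infinite sets to the empty one, so that a nonzero value also
   says that the sphere (resp. ball) is finite. *)
Definition sphere_size p (n : nat) : nat := #|` fset_set (sphere p n)|%fset.
Definition ball_size p (n : nat) : nat := #|` fset_set (ball p n)|%fset.

End ThompsonF.

(* Main.v *)
(* The Schreier graph is a tree up to loops and doubled edges.  From every vertex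
   other than the root 1/2 exactly one edge, possibly doubled, leads back towards
   the root; the number of outward edges depends only on whether the vertex lies
   in (0, 1/2), (1/2, 3/4), [3/4, 7/8) or [7/8, 1).  Hence the spheres are the
   levels of this tree, and both the vertices and the geodesic words of given
   length satisfy linear recurrences: in (1/2, 3/4) there is one child in each of
   the first three regions, in [3/4, 7/8) one in the second and one, by a double
   edge, in the last, and each of the two extreme regions only continues into
   itself, by a simple edge on the left and a double edge on the right. *)
Require Import Defs.
From mathcomp Require Import all_boot all_order all_algebra.
From mathcomp Require Import all_classical all_reals all_analysis.
From mathcomp Require Import finmap lra zify ring.
Set Implicit Arguments.
Unset Strict Implicit.
Unset Printing Implicit Defensive.
Import Order.TTheory GRing.Theory Num.Theory.
Import numFieldNormedType.Exports.
Local Open Scope classical_set_scope.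
Local Open Scope ring_scope.

(** * The orbit of 1/2 *)

Arguments act : simpl never.

Section Orbit.
Context {R : realType}.
Implicit Types (a b c t y : R) (f g : R -> R) (s : seq R).

Lemma dyadicD a b : dyadic a -> dyadic b -> dyadic (a + b).
Proof.
move=> [m [k ->]] [n [l ->]]; exists (m * 2 ^+ l + n * 2 ^+ k), (k + l)%N.
rewrite intrD !intrM !rmorphXn /= exprD.
have : (2 : R) ^+ k != 0 by rewrite expf_neq0.
have : (2 : R) ^+ l != 0 by rewrite expf_neq0.
by move=> ? ?; field; apply/andP.
Qed.

Lemma dyadicM a b : dyadic a -> dyadic b -> dyadic (a * b).
Proof.
by move=> [m [k ->]] [n [l ->]]; exists (m * n), (k + l)%N;
  rewrite intrM exprD invfM mulrACA.
Qed.

Lemma dyadic_act l t : dyadic t -> dyadic (act l t).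
Proof.
have dy m k c : c = m%:~R / 2 ^+ k -> dyadic c by move=> ->; exists m, k.
have d1 : dyadic (1 : R) by apply: (dy 1 0%N); lra.
have dN1 : dyadic (-1 : R) by apply: (dy (-1) 0%N); lra.
have d2 : dyadic (2 : R) by apply: (dy 2 0%N); lra.
have dh : dyadic (2^-1 : R) by apply: (dy 1 1%N); rewrite expr1; lra.
have dq : dyadic (4^-1 : R) by apply: (dy 1 2%N); lra.
have dNq : dyadic (- 4^-1 : R) by apply: (dy (-1) 2%N); lra.
have dx0 (u : R) : dyadic u -> dyadic (x0 u).
  move=> du; rewrite /x0 !mul1r; do ![case: ifP => _];
    by repeat first [assumption | apply: dyadicD | apply: dyadicM].
have dx0i (u : R) : dyadic u -> dyadic (x0inv u).
  move=> du; rewrite /x0inv !mul1r; do ![case: ifP => _];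
    by repeat first [assumption | apply: dyadicD | apply: dyadicM].
case: l => [[] []] dt; rewrite /act; [| |exact: dx0i|exact: dx0].
- rewrite /x1inv !mul1r; case: ifP => // _; apply: dyadicD => //.
  by apply: dyadicM => //; apply: dx0i; apply: dyadicD => //; exact: dyadicM.
- rewrite /x1 !mul1r; case: ifP => // _; apply: dyadicD => //.
  by apply: dyadicM => //; apply: dx0; apply: dyadicD => //; exact: dyadicM.
Qed.

Definition letter_inv (l : letter) : letter := (l.1, ~~ l.2).
Arguments letter_inv : simpl never.

Lemma actK l : cancel (act l) (act (letter_inv l) : R -> R).
Proof.
by case: l => [[] []]; [exact: x1invK|exact: x1K|exact: x0invK|exact: x0K].
Qed.

Lemma letter_invK : involutive letter_inv.
Proof. by case=> [i []]. Qed.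

Lemma act_lt l : {homo (act l : R -> R) : t u / t < u}.
Proof.
by case: l => [[] []] t u tu; rewrite /act /x1inv /x1 /x0 /x0inv;
  do ![case: ifPn]; lra.
Qed.

(** Slopes are powers of 2 from the outset, so that the derivative condition of F is carried along
    with piecewise linearity. The intervals range over the whole line. *)
Definition affine_off s f := forall a b, a < b ->
  (forall c, c \in s -> ~~ (a < c < b)) ->
  exists (k : int) (q : R), forall t, a <= t <= b -> f t = 2 ^ k * t + q.

(** * Affine pieces of the generators and their inverses *)

Lemma x0_lower t : t <= 1 / 2 -> x0 t = t / 2.
Proof. by rewrite /x0; do ![case: ifPn]; lra. Qed.

Lemma x0_middle t : 1 / 2 <= t <= 3 / 4 -> x0 t = t - 1 / 4.
Proof. by rewrite /x0; do ![case: ifPn]; lra. Qed.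

Lemma x0_upper t : 3 / 4 <= t -> x0 t = 2 * t - 1.
Proof. by rewrite /x0; do ![case: ifPn]; lra. Qed.

Lemma x0inv_lower t : t <= 1 / 4 -> x0inv t = 2 * t.
Proof. by rewrite /x0inv; do ![case: ifPn]; lra. Qed.

Lemma x0inv_middle t : 1 / 4 <= t <= 1 / 2 -> x0inv t = t + 1 / 4.
Proof. by rewrite /x0inv; do ![case: ifPn]; lra. Qed.

Lemma x0inv_upper t : 1 / 2 <= t -> x0inv t = (t + 1) / 2.
Proof. by rewrite /x0inv; do ![case: ifPn]; lra. Qed.

Lemma x1_left t : t <= 1 / 2 -> x1 t = t.
Proof. by rewrite /x1 /x0; do ![case: ifPn]; lra. Qed.

Lemma x1_lower t : 1 / 2 <= t <= 3 / 4 -> x1 t = t / 2 + 1 / 4.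
Proof. by rewrite /x1 /x0; do ![case: ifPn]; lra. Qed.

Lemma x1_middle t : 3 / 4 <= t <= 7 / 8 -> x1 t = t - 1 / 8.
Proof. by rewrite /x1 /x0; do ![case: ifPn]; lra. Qed.

Lemma x1_upper t : 7 / 8 <= t -> x1 t = 2 * t - 1.
Proof. by rewrite /x1 /x0; do ![case: ifPn]; lra. Qed.

Lemma x1inv_left t : t <= 1 / 2 -> x1inv t = t.
Proof. by rewrite /x1inv /x0inv; do ![case: ifPn]; lra. Qed.

Lemma x1inv_lower t : 1 / 2 <= t <= 5 / 8 -> x1inv t = 2 * t - 1 / 2.
Proof. by rewrite /x1inv /x0inv; do ![case: ifPn]; lra. Qed.

Lemma x1inv_middle t : 5 / 8 <= t <= 3 / 4 -> x1inv t = t + 1 / 8.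
Proof. by rewrite /x1inv /x0inv; do ![case: ifPn]; lra. Qed.

Lemma x1inv_upper t : 3 / 4 <= t -> x1inv t = (t + 1) / 2.
Proof. by rewrite /x1inv /x0inv; do ![case: ifPn]; lra. Qed.

Lemma affine_slope1 f a b (q : R) : (forall t, a <= t <= b -> f t = t + q) ->
  exists (k : int) (q : R), forall t, a <= t <= b -> f t = 2 ^ k * t + q.
Proof. by move=> h; exists 0, q => t /h ->; rewrite expr0z mul1r. Qed.

Lemma affine_slope2 f a b (q : R) : (forall t, a <= t <= b ->
  f t = 2 * t + q) ->
  exists (k : int) (q : R), forall t, a <= t <= b -> f t = 2 ^ k * t + q.
Proof. by move=> h; exists 1, q => t /h ->; rewrite expr1z. Qed.

Lemma affine_slopeV f a b (q : R) : (forall t, a <= t <= b ->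
  f t = t / 2 + q) ->
  exists (k : int) (q : R), forall t, a <= t <= b -> f t = 2 ^ k * t + q.
Proof. by move=> h; exists (-1), q => t /h ->; rewrite exprN1 mulrC. Qed.

Lemma affine_off_act l : exists2 s, {in s, forall c, dyadic c} &
  affine_off s (act l).
Proof.
have dy (m : int) k (c : R) : c = m%:~R / 2 ^+ k -> dyadic c by move=> ->;
  exists m, k.
have dy4 : dyadic (1 / 4 : R) by apply: (dy 1 2%N); lra.
have dy2 : dyadic (1 / 2 : R) by apply: (dy 1 1%N); rewrite expr1; lra.
have dy58 : dyadic (5 / 8 : R) by apply: (dy 5 3%N); lra.
have dy34 : dyadic (3 / 4 : R) by apply: (dy 3 2%N); lra.
have dy78 : dyadic (7 / 8 : R) by apply: (dy 7 3%N); lra.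
clear dy.
(* An interval whose interior misses [c] lies on one side of [c]. Going through the breakpoints from
   left to right then locates the piece that contains it. *)
have off s a b : (forall c, c \in s -> ~~ (a < c < b)) ->
    forall c, c \in s -> b <= c \/ c <= a.
  by move=> s_ab c /s_ab; rewrite negb_and -!leNgt orbC => /orP.
case: l => [[] []].
- exists [:: 1 / 2; 5 / 8; 3 / 4] => [c|a b ab /off h].
    by rewrite !inE => /or3P[] /eqP ->.
  have := h (1 / 2); have := h (5 / 8); have := h (3 / 4); clear h.
  rewrite !inE !eqxx ?orbT => /(_ isT) h3 /(_ isT) h2 /(_ isT) [h1|h1].
    by apply: (@affine_slope1 _ _ _ 0) => t ?; rewrite /act x1inv_left; lra.
  case: h2 => h2.
    by apply: (@affine_slope2 _ _ _ (- (1 / 2))) => t ?;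
      rewrite /act x1inv_lower; lra.
  case: h3 => h3.
    by apply: (@affine_slope1 _ _ _ (1 / 8)) => t ?; rewrite /act x1inv_middle;
      lra.
  by apply: (@affine_slopeV _ _ _ (1 / 2)) => t ?; rewrite /act x1inv_upper;
    lra.
- exists [:: 1 / 2; 3 / 4; 7 / 8] => [c|a b ab /off h].
    by rewrite !inE => /or3P[] /eqP ->.
  have := h (1 / 2); have := h (3 / 4); have := h (7 / 8); clear h.
  rewrite !inE !eqxx ?orbT => /(_ isT) h3 /(_ isT) h2 /(_ isT) [h1|h1].
    by apply: (@affine_slope1 _ _ _ 0) => t ?; rewrite /act x1_left; lra.
  case: h2 => h2.
    by apply: (@affine_slopeV _ _ _ (1 / 4)) => t ?; rewrite /act x1_lower; lra.
  case: h3 => h3.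
    by apply: (@affine_slope1 _ _ _ (- (1 / 8))) => t ?;
      rewrite /act x1_middle; lra.
  by apply: (@affine_slope2 _ _ _ (- 1)) => t ?; rewrite /act x1_upper; lra.
- exists [:: 1 / 4; 1 / 2] => [c|a b ab /off h].
    by rewrite !inE => /orP[] /eqP ->.
  have := h (1 / 4); have := h (1 / 2); clear h.
  rewrite !inE !eqxx ?orbT => /(_ isT) h2 /(_ isT) [h1|h1].
    by apply: (@affine_slope2 _ _ _ 0) => t ?; rewrite /act x0inv_lower; lra.
  case: h2 => h2.
    by apply: (@affine_slope1 _ _ _ (1 / 4)) => t ?; rewrite /act x0inv_middle;
      lra.
  by apply: (@affine_slopeV _ _ _ (1 / 2)) => t ?; rewrite /act x0inv_upper;
    lra.
- exists [:: 1 / 2; 3 / 4] => [c|a b ab /off h].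
    by rewrite !inE => /orP[] /eqP ->.
  have := h (1 / 2); have := h (3 / 4); clear h.
  rewrite !inE !eqxx ?orbT => /(_ isT) h2 /(_ isT) [h1|h1].
    by apply: (@affine_slopeV _ _ _ 0) => t ?; rewrite /act x0_lower; lra.
  case: h2 => h2.
    by apply: (@affine_slope1 _ _ _ (- (1 / 4))) => t ?;
      rewrite /act x0_middle; lra.
  by apply: (@affine_slope2 _ _ _ (- 1)) => t ?; rewrite /act x0_upper; lra.
Qed.

(* A subclass of F in which composition with the generators is easily followed:
   it consists of homeomorphisms of the whole line, and the breakpoints of a
   composite are controlled by an inverse preserving dyadic numbers. *)
Definition dyadic_pl f := [/\ {homo f : t u / t < u}, f 0 = 0, f 1 = 1,
  exists g, [/\ cancel f g, cancel g f & forall t, dyadic t -> dyadic (g t)] &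
  exists2 s, {in s, forall c, dyadic c} & affine_off s f].

Lemma dyadic_pl_id : dyadic_pl id.
Proof.
split=> //; first by exists id.
exists [::] => // a b _ _; exists 0, 0 => t _.
by rewrite expr0z mul1r addr0.
Qed.

Lemma act0 l : act l (0 : R) = 0.
Proof.
by case: l => [[] []]; rewrite /act /x1inv /x1 /x0 /x0inv; do ![case: ifPn];
  lra.
Qed.

Lemma act1 l : act l (1 : R) = 1.
Proof.
by case: l => [[] []]; rewrite /act /x1inv /x1 /x0 /x0inv; do ![case: ifPn];
  lra.
Qed.

Lemma dyadic_pl_act l f : dyadic_pl f -> dyadic_pl (act l \o f).
Proof.
move=> [f_lt f0 f1 [g [fK gK g_dy]] [s s_dy sf]].
have [s' s'_dy s'l] := affine_off_act l.
split=> /=.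
- by move=> t u tu; exact/act_lt/f_lt.
- by rewrite f0 act0.
- by rewrite f1 act1.
- exists (g \o act (letter_inv l)); split=> [t|t|t t_dy] /=.
  + by rewrite actK fK.
  + by rewrite gK -{1}[l]letter_invK actK.
  + exact/g_dy/dyadic_act.
(* The composite can break only where [f] does, or where [f] takes a value at which the letter
   breaks; [map g s'] lists the latter points. *)
exists (s ++ map g s').
  by move=> c; rewrite mem_cat => /orP[/s_dy//|/mapP[d /s'_dy + ->]];
    exact: g_dy.
move=> a b ab sab.
have [c c_s|k [q fE]] := sf a b ab; first by apply: sab; rewrite mem_cat c_s.
have [|c c_s|m [r lE]] := s'l (f a) (f b); first exact: f_lt.
  apply: contra (sab (g c) _); last by rewrite mem_cat map_f ?orbT.
  rewrite -{1 2}[c]gK => /andP[fac fcb]; have f_mono := leW_mono (le_mono f_lt).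
  by rewrite !f_mono in fac fcb; rewrite fac.
exists (m + k), (2 ^ m * q + r) => t tab.
rewrite /= lE; first by rewrite fE // mulrDr addrA expfzDr // mulrA.
by rewrite !(le_mono f_lt).
Qed.

(** * Differentiability of maps that are affine off a finite set *)

Lemma exists_gap s t : exists2 e, 0 < e &
  forall c, c \in s -> ~~ (t - e < c < t) && ~~ (t < c < t + e).
Proof.
elim: s => [|c s [e e0 es]]; first by exists 1.
have [->|ct] := eqVneq c t.
  exists e => // d; rewrite inE => /predU1P[->|/es//]; rewrite !ltxx andbF //.
exists (Num.min e `|c - t|); first by rewrite lt_min e0 normr_gt0 subr_eq0.
move=> d; rewrite inE => /predU1P[->|/es]; last first.
  by case: (leP e `|c - t|) => // h; rewrite !negb_and -!leNgt; lra.
by case: (leP e `|c - t|); case: (lerP 0 (c - t)) => h1;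
  rewrite ?(ger0_norm h1) ?(ltr0_norm h1) !negb_and -!leNgt; lra.
Qed.

Lemma is_derive_affine (k q t : R) : is_derive t 1 (fun u => k * u + q) k.
Proof.
have -> : (fun u => k * u + q) = (k *: (@id R)) + cst q by apply/funext.
apply: is_derive_eq; by rewrite /= addr0 /GRing.scale /= mulr1.
Qed.

(** The point [t] may belong to [s], but a derivative that exists equals the right derivative, which
    is the slope of the piece just to the right of [t]. *)
Lemma affine_off_derive1 s f t : affine_off s f -> derivable f t 1 ->
  exists k : int, derive1 f t = 2 ^ k.
Proof.
move=> sf ft; have [e e0 es] := exists_gap s t.
have [|c /es /andP[]//|k [q fE]] := sf t (t + e); first by rewrite ltrDl.
exists k; rewrite derive1E /derive cvg_at_rightE //.
apply: cvg_lim => //; apply: cvg_near_cst.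
near=> h.
have h0 : 0 < h by near: h; exact: nbhs_right_gt.
have he : h < e by near: h; exact: nbhs_right_lt.
rewrite /= /GRing.scale /= mulr1 !fE; try lra.
by field; rewrite gt_eqF.
Unshelve. all: by end_near. Qed.

Lemma affine_off_derivable s f t : affine_off s f -> t \notin s ->
  derivable f t 1.
Proof.
move=> sf ts; have [e e0 es] := exists_gap s t.
have [|c cs|k [q fE]] := sf (t - e) (t + e); first by lra.
  have /andP[] := es _ cs; rewrite !negb_and -!leNgt => h1 h2.
  have : c != t by apply: contraNneq ts => <-.
  by rewrite neq_lt; lra.
suff [] : is_derive t 1 f (2 ^ k) by [].
apply: near_eq_is_derive (is_derive_affine (2 ^ k) q t).
near=> u; rewrite fE //.
have : `|t - u| < e by near: u; exact: cvgr_dist_lt.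
by rewrite ltr_distl; lra.
Unshelve. all: by end_near. Qed.

Lemma dyadic_pl_thompsonF f : dyadic_pl f -> thompsonF f.
Proof.
move=> [f_lt f0 f1 [g [fK gK g_dy]] [s s_dy sf]].
have f_le := le_mono f_lt.
have f_surj : set_surj `[0, 1] `[0, 1] f.
  move=> y; rewrite /= in_itv /= => y01; exists (g y) => //=.
  by rewrite in_itv /= -f_le -[_ <= 1]f_le f0 f1 gK.
split; split.
- split=> //.
  + by move=> t; rewrite /= !in_itv /= -{2}f0 -{2}f1 !f_le.
  + by move=> t u _ _ /(can_inj fK).
(* Continuity follows from monotonicity and surjectivity, without gluing the affine pieces. *)
- apply: segment_inc_surj_continuous; last by rewrite f0 f1.
  by move=> t u _ _; rewrite f_le.
- by move=> t u _ _; exact: f_lt.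
- exists s => a b _ ab _ /(sf _ _ ab)[k [q fE]].
  by exists (2 ^ k), q.
- apply: (@sub_finite_set _ _ [set` s]); last exact: finite_seq.
  move=> t [_ ft] /=; apply/negP => /negP ts;
    exact/ft/(affine_off_derivable sf).
- move=> t [_ ft]; apply: s_dy; apply/negP => /negP ts.
  exact/ft/(affine_off_derivable sf).
- by move=> t _; exact: affine_off_derive1 sf.
Qed.

Lemma endpoint_rcons y w l : endpoint y (rcons w l) = act l (endpoint y w).
Proof. by rewrite /endpoint foldl_rcons. Qed.

(** The whole word acts as one element of F, obtained letter by letter inside the class
    [dyadic_pl]. *)
Lemma vertex_endpoint w : vertex (endpoint (1 / 2 : R) w).
Proof.
exists (fun t => endpoint t w) => //; apply: dyadic_pl_thompsonF.
elim/last_ind: w => [|w l IH]; first exact: dyadic_pl_id.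
have -> : (fun t => endpoint t (rcons w l)) = act l \o (fun t => endpoint t w).
  by apply/funext => t; rewrite endpoint_rcons.
exact: dyadic_pl_act.
Qed.

End Orbit.

(** * The tree of outward edges *)

Section Tree.
Context {R : realType}.
Implicit Types (y z : R) (l : letter) (w : seq letter).
Local Notation p := (1 / 2 : R).
Local Notation X0 := (false, false).
Local Notation X0inv := (false, true).
Local Notation X1 := (true, false).
Local Notation X1inv := (true, true).

(** Left out are the letters that fix [y] or lead back to its parent. In [3/4, 1) both inverse
    generators occur, which is the doubled edge. *)
Definition outward y : seq letter :=
  if y < 1 / 2 then [:: X0] else if y == 1 / 2 then [:: X0; X0inv]
  else if y < 3 / 4 then [:: X0; X1; X0inv]
  else if y < 7 / 8 then [:: X1; X0inv; X1inv] else [:: X0inv; X1inv].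

(* Wherever x_1^-1 points outward, it acts as x_0^-1. *)
Definition branches y : seq letter := [seq l <- outward y | l != X1inv].

(* The value at the root 1/2 is irrelevant. *)
Definition parent y : R :=
  if y < 1 / 2 then x0inv y else if y < 3 / 4 then x1inv y else x0 y.

Lemma outward_uniq y : uniq (outward y).
Proof. by rewrite /outward; do ![case: ifP => _]. Qed.

Lemma act_in01 l y : 0 < y < 1 -> 0 < act l y < 1.
Proof. by case/andP => /(act_lt l) + /(act_lt l);
  rewrite act0 act1 => -> ->. Qed.

Lemma parent_act y l : 0 < y < 1 -> l \in outward y ->
  act l y != p /\ parent (act l y) = y.
Proof.
pose good (z : R) := z != p /\ parent z = y.
(* The region in which the child [z] lands decides which letter [parent] applies to it. *)
have lower z : z < 1 / 2 -> x0inv z = y -> good z.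
  by move=> z2 zy; split; [rewrite lt_eqF|rewrite /parent z2].
have middle z : 1 / 2 < z < 3 / 4 -> x1inv z = y -> good z.
  case/andP=> z2 z34 zy; split; first by rewrite gt_eqF.
  by rewrite /parent ltNge ltW //= z34.
have upper z : 3 / 4 <= z -> x0 z = y -> good z.
  move=> z34 zy; split; first by rewrite gt_eqF //; lra.
  by rewrite /parent !ltNge z34 ifN // negbK; lra.
move=> y01; rewrite /outward; case: ltP => y2; last case: eqVneq => [y2E|y2N].
- rewrite inE => /eqP -> /=; apply: lower; rewrite /act ?x0K // x0_lower; lra.
- rewrite !inE => /orP[] /eqP ->.
    by apply: lower; rewrite /act ?x0K // x0_lower; lra.
  by apply: upper; rewrite /act ?x0invK // x0inv_upper; lra.
- have {}y2 : 1 / 2 < y by rewrite lt_neqAle eq_sym y2N.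
  case: ltP => [y34|y34]; last case: ltP => [y78|y78].
  + rewrite !inE => /or3P[] /eqP ->.
    * by apply: lower; rewrite /act ?x0K // x0_middle; lra.
    * by apply: middle; rewrite /act ?x1K // x1_lower; lra.
    * by apply: upper; rewrite /act ?x0invK // x0inv_upper; lra.
  + rewrite !inE => /or3P[] /eqP ->.
    * by apply: middle; rewrite /act ?x1K // x1_middle; lra.
    * by apply: upper; rewrite /act ?x0invK // x0inv_upper; lra.
    (* On [3/4, 1) both inverse generators are (t + 1) / 2, so [x0] undoes [x1inv] here. *)
    * by apply: upper; rewrite /act x1inv_upper ?x0_upper; lra.
  + rewrite !inE => /orP[] /eqP ->.
    * by apply: upper; rewrite /act ?x0invK // x0inv_upper; lra.
    * by apply: upper; rewrite /act x1inv_upper ?x0_upper; lra.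
Qed.

Lemma act_not_outward y l : 0 < y < 1 -> l \notin outward y ->
  act l y = y \/ y != p /\ act l y = parent y.
Proof.
move=> y01; rewrite /outward /parent; case: ltP => y2.
  have yN : y != p by rewrite lt_eqF.
  by case: l => [[] []] // _; [left|left|right];
    rewrite /act ?x1_left ?x1inv_left ?ltW.
case: eqVneq => [->|y2N].
  by case: l => [[] []] // _; left; rewrite /act ?x1_left ?x1inv_left.
case: ltP => y34; first by case: l => [[] []] // _; right.
case: ltP => y78; first by case: l => [[] []] // _; right.
(* On [7/8, 1) the edge back is doubled: [x0] and [x1] are both 2t - 1 there. *)
case: l => [[] []] // _; right; split; rewrite // /act.
by rewrite x1_upper ?x0_upper.
Qed.

Lemma branches_sub y : {subset branches y <= outward y}.
Proof. by move=> l; rewrite mem_filter => /andP[]. Qed.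

Lemma branches_act y l : l \in outward y ->
  exists2 l', l' \in branches y & act l' y = act l y.
Proof.
have [->|lN] := eqVneq l X1inv; last by exists l => //; rewrite mem_filter lN.
rewrite /branches /outward; case: ltP => // y2; case: eqVneq => // _.
by case: ltP => // y34; case: ltP => // y78 _; exists X0inv;
  rewrite // /act x0inv_upper ?x1inv_upper.
Qed.

(** Different branches lead to different intervals among (0, 1/2), (1/2, 3/4) and [3/4, 1). *)
Lemma branches_act_inj y : 0 < y < 1 ->
  {in branches y &, injective (fun l => act l y)}.
Proof.
move=> y01; rewrite /branches /outward; case: ltP => y2 /=.
  by move=> l l'; rewrite !inE => /eqP -> /eqP ->.
case: eqVneq => [->|y2N] /=.
  by move=> l l'; rewrite !inE => /orP[] /eqP -> /orP[] /eqP -> //;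
    move=> h; exfalso; move: h; rewrite /act x0_lower ?x0inv_upper; lra.
have {}y2 : 1 / 2 < y by rewrite lt_neqAle eq_sym y2N.
case: ltP => [y34|y34] /=; last case: ltP => [y78|y78] /=.
- by move=> l l'; rewrite !inE => /or3P[] /eqP -> /or3P[] /eqP -> //;
    move=> h; exfalso; move: h; rewrite /act ?x0_middle ?x0inv_upper ?x1_lower;
      lra.
- by move=> l l'; rewrite !inE => /orP[] /eqP -> /orP[] /eqP -> //;
    move=> h; exfalso; move: h; rewrite /act ?x0inv_upper ?x1_middle; lra.
- by move=> l l'; rewrite !inE => /eqP -> /eqP ->.
Qed.

(** With [next := outward] these turn out to be the geodesic words; with [next := branches] there is
    one word for each vertex of the level. *)
Fixpoint words (next : R -> seq letter) n : seq (seq letter) :=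
  if n is m.+1 then [seq rcons w l | w <- words next m, l <- next (endpoint p w)]
  else [:: [::]].

Definition level n : seq R := [seq endpoint p w | w <- words branches n].

Lemma wordsSP next n v : reflect
  (exists w l, [/\ w \in words next n, l \in next (endpoint p w) & v =
    rcons w l])
  (v \in words next n.+1).
Proof. exact: allpairsPdep. Qed.

Lemma words_uniq next n : (forall y, uniq (next y)) -> uniq (words next n).
Proof.
move=> next_uniq; elim: n => //= n IH; apply: allpairs_uniq_dep => //.
by move=> [w l] [w' l'] _ _ /= /rcons_inj [-> ->].
Qed.

Lemma endpoint_in01 w : 0 < endpoint p w < 1.
Proof.
elim/last_ind: w => [|w l IH]; first by rewrite /endpoint /=; lra.
by rewrite endpoint_rcons act_in01.
Qed.

Lemma level_in01 n y : y \in level n -> 0 < y < 1.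
Proof. by case/mapP => w _ ->; exact: endpoint_in01. Qed.

Lemma mem_level0 y : (y \in level 0) = (y == p).
Proof. by rewrite inE. Qed.

Lemma level_act n y l : y \in level n -> l \in outward y ->
  act l y \in level n.+1.
Proof.
case/mapP => w w_n -> /branches_act[l' l'_y <-].
by rewrite -endpoint_rcons; apply: map_f; apply/wordsSP; exists w, l'.
Qed.

Lemma levelS_parent n y : y \in level n.+1 -> y != p /\ parent y \in level n.
Proof.
case/mapP => _ /wordsSP[w [l [w_n l_w ->]]] ->; rewrite endpoint_rcons.
have [-> ->] := parent_act (endpoint_in01 w) (branches_sub l_w).
by split=> //; exact: map_f.
Qed.

(** Passing to parents lowers both indices together, and the root lies in no level of positive
    index. *)
Lemma level_disjoint m n y : y \in level m -> y \in level n -> m = n.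
Proof.
elim: m n y => [|m IH] [|n] y //.
- by rewrite mem_level0 => /eqP -> /levelS_parent[]; rewrite eqxx.
- by rewrite mem_level0 => /levelS_parent[] + _ /eqP yp; rewrite yp eqxx.
- by case/levelS_parent => _ ym /levelS_parent[_ yn]; rewrite (IH _ _ ym yn).
Qed.

Lemma level_uniq n : uniq (level n).
Proof.
rewrite map_inj_in_uniq.
  by apply: words_uniq => y; rewrite filter_uniq ?outward_uniq.
elim: n => [|n IH] v v'; first by rewrite !inE => /eqP -> /eqP ->.
case/wordsSP => w [l [w_n l_w ->]] /wordsSP[w' [l' [w'_n l'_w' ->]]].
rewrite !endpoint_rcons => ll'.
have [_ wE] := parent_act (endpoint_in01 w) (branches_sub l_w).
have [_ w'E] := parent_act (endpoint_in01 w') (branches_sub l'_w').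
(* Equal endpoints have equal parents, so the prefixes agree by induction; siblings being distinct,
   the last letters agree too. *)
have ww' : w = w' by apply: IH; rewrite // -wE -w'E ll'.
by subst w'; rewrite (branches_act_inj (endpoint_in01 w) l_w l'_w' ll').
Qed.

Lemma level_act_not_outward n y l : y \in level n -> l \notin outward y ->
  exists2 m, (m <= n)%N & act l y \in level m.
Proof.
move=> yn /(act_not_outward (level_in01 yn))[->|[yp ->]]; first by exists n.
case: n => [|n] in yn *; first by rewrite mem_level0 (negPf yp) in yn.
by exists n => //; case/levelS_parent: yn.
Qed.

(** A letter raises the level by at most one. This is the lower bound for the distance from the
    root. *)
Lemma endpoint_level w : exists2 m, (m <= size w)%N & endpoint p w \in level m.
Proof.
elim/last_ind: w => [|w l [m mw w_m]]; first by exists 0%N; rewrite ?mem_level0.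
rewrite endpoint_rcons size_rcons.
have [l_out|l_nout] := boolP (l \in outward (endpoint p w)).
  by exists m.+1 => //; exact: level_act.
have [k km lk] := level_act_not_outward w_m l_nout.
by exists k => //; rewrite (leq_trans km) // leqW.
Qed.

(** To reach level n with n letters, every letter has to raise the level, hence to point outward. *)
Lemma mem_words_outward n w :
  (w \in words outward n) = (size w == n) && (endpoint p w \in level n).
Proof.
elim: n w => [|n IH] w.
  rewrite inE; case: eqVneq => [->|];
    first by rewrite mem_level0 /endpoint /= !eqxx.
  by case: w.
apply/wordsSP/andP => [[v [l [+ l_v ->]]]|[]].
  rewrite IH => /andP[/eqP <- v_n]; rewrite size_rcons endpoint_rcons.
  by rewrite eqxx level_act.
case/lastP: w => // v l; rewrite size_rcons eqSS => /eqP vn.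
rewrite endpoint_rcons => l_n; have [m mn v_m] := endpoint_level v.
exists v, l; rewrite IH vn eqxx /=.
have [l_out|l_nout] := boolP (l \in outward (endpoint p v)).
  by have [<-] := level_disjoint (level_act v_m l_out) l_n.
have [k km lk] := level_act_not_outward v_m l_nout.
(* Without an outward last letter the level would be at most n, not n + 1. *)
have := level_disjoint lk l_n; lia.
Qed.

(** * Walks, words and graph distance from the root *)

Lemma adjacent_act y l : vertex y -> vertex (act l y) ->
  Defs.adjacent y (act l y).
Proof.
move=> vy vl; exists l.1; case: l vl => [i []] vl; [right|left]; split=> //.
  by case: i {vl}; rewrite /act /= ?x1invK ?x0invK.
Qed.

Lemma adjacentP y z : Defs.adjacent y z -> exists l, z = act l y.
Proof.
case=> i [[_ _ ->]|[_ _ ->]]; first by exists (i, false); case: i.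
by exists (i, true); case: i; rewrite /act /= ?x1K ?x0K.
Qed.

Lemma walk_root n z : walk n p z <-> exists2 w, size w = n & z = endpoint p w.
Proof.
split=> [|[w <- ->]].
  elim: n p => [|n IH] y /=; first by case=> _ ->; exists [::].
  by case=> _ /adjacentP[l ->] /IH[w <- ->]; exists (l :: w).
(* Starting points of the form [endpoint p v] keep the induction inside the orbit, by
   [vertex_endpoint]. *)
suff walkP v : walk (size w) (endpoint p v) (endpoint (endpoint p v) w).
  exact: (walkP [::]).
elim: w v => [|l w IH] v /=; first by split; first exact: vertex_endpoint.
exists (act l (endpoint p v)); last by have := IH (rcons v l);
  rewrite endpoint_rcons.
by apply: adjacent_act; rewrite -?endpoint_rcons; exact: vertex_endpoint.
Qed.

Lemma level_word n z : z \in level n ->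
  exists2 w, size w = n & z = endpoint p w.
Proof.
case/mapP => w w_n ->; exists w => //.
elim: n w w_n => [|n IH] w; first by rewrite inE => /eqP ->.
by case/wordsSP => v [l [/IH <- _ ->]]; rewrite size_rcons.
Qed.

(** A vertex of level n is reached by n letters ([level_word]) and by no fewer ([endpoint_level],
    the levels being disjoint). *)
Lemma dist_level n z : dist p z n <-> z \in level n.
Proof.
split=> [[/walk_root[w wn zw] n_min]|zn].
  have [m mw] := endpoint_level w; rewrite -zw => zm.
  suff <- : m = n by [].
  apply/eqP; rewrite eqn_leq -{1}wn mw /= n_min //.
  exact/walk_root/level_word.
split; first exact/walk_root/level_word.
move=> m /walk_root[w <- zw]; have [k kw] := endpoint_level w.
by rewrite -zw => /level_disjoint/(_ zn) <-.
Qed.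

(** * Cardinalities as sizes of duplicate-free lists *)

Lemma fset_set_seq (s : seq R) : uniq s -> #|` fset_set [set` s]|%fset = size s.
Proof.
move=> s_uniq; have -> : [set` s] = [set` [fset x in s]%fset].
  by apply/seteqP; split => x /=; rewrite inE.
by rewrite set_fsetK card_fseq undup_id.
Qed.

Lemma sphere_sizeE n : sphere_size p n = size (level n).
Proof.
rewrite /sphere_size -(fset_set_seq (level_uniq n));
  congr (#|` fset_set _|)%fset.
by apply/seteqP; split=> z /dist_level.
Qed.

Lemma ball_sizeE n : ball_size p n = (\sum_(k < n.+1) sphere_size p k)%N.
Proof.
pose B n := flatten [seq level k | k <- iota 0 n.+1].
have memB m z : reflect (exists2 k, (k <= m)%N & z \in level k) (z \in B m).
  apply: (iffP flatten_mapP) => -[k]; first by rewrite mem_iota; exists k.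
  by move=> km zk; exists k; rewrite // mem_iota.
have BS m : B m.+1 = B m ++ level m.+1.
  by rewrite /B -[m.+2]addn1 iotaD map_cat flatten_cat /= cats0.
have B_uniq m : uniq (B m).
  elim: m => [|m IH]; first by rewrite /B /=.
  rewrite BS cat_uniq IH level_uniq andbT /=; apply/hasPn => z zm.
  apply/negP => /memB[k km zk]; have := level_disjoint zk zm; lia.
have -> : ball_size p n = size (B n).
  rewrite -(fset_set_seq (B_uniq n)); congr (#|` fset_set _|)%fset.
  apply/seteqP; split=> z /=; first by case=> m mn /dist_level zm; apply/memB;
    exists m.
  by case/memB => m mn /dist_level; exists m.
elim: n => [|n IH]; first by rewrite big_ord1 sphere_sizeE.
by rewrite BS size_cat IH [RHS]big_ord_recr /= sphere_sizeE.
Qed.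

Lemma geodesic_growthE n : geodesic_growth p n = size (words outward n).
Proof.
rewrite /geodesic_growth cardE -(size_map val); apply: perm_size.
apply: uniq_perm.
- by rewrite map_inj_uniq ?enum_uniq //; exact: val_inj.
- by apply: words_uniq => y; exact: outward_uniq.
move=> w; rewrite mem_words_outward; apply/mapP/andP => [[t + ->]|[wn w_n]].
  by rewrite mem_enum inE => /asboolP/dist_level; rewrite size_tuple eqxx.
exists (Tuple wn) => //; rewrite mem_enum inE; exact/asboolP/dist_level.
Qed.

(** This recursion branches at the first letter, whereas [words] extends at the last one; here the
    count can be computed region by region. *)
Fixpoint descendants (next : R -> seq letter) n y : nat :=
  if n is m.+1 then (\sum_(l <- next y) descendants next m (act l y))%N else 1%N.

Lemma size_words next n : size (words next n) = descendants next n p.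
Proof.
(* Cutting words of length n + m after n letters interpolates between the two recursions; m = 0
   gives the claim. *)
suff sumE m : (\sum_(w <- words next n) descendants next m (endpoint p w))%N =
    descendants next (n + m) p by rewrite -[n in RHS]addn0 -sumE sum1_size.
elim: n m => [|n IH] m; first by rewrite big_seq1.
rewrite addSnnS -IH big_allpairs_dep; apply: eq_bigr => w _.
by apply: eq_bigr => l _; rewrite endpoint_rcons.
Qed.

End Tree.

(** * Counting vertices and geodesic words *)

Fixpoint fib n : nat :=
  if n is m.+1 then if m is k.+1 then (fib m + fib k)%N else 1%N else 0%N.

Lemma fibSS n : fib n.+2 = (fib n.+1 + fib n)%N. Proof. by []. Qed.

Arguments fib : simpl never.

Section Counting.
Context {R : realType}.
Implicit Types (y : R) (n : nat).

Lemma outward_lower y : y < 1 / 2 -> outward y = [:: (false, false)].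
Proof. by rewrite /outward => ->. Qed.

Lemma outward_middle y : 1 / 2 < y < 3 / 4 ->
  outward y = [:: (false, false); (true, false); (false, true)].
Proof. by case/andP=> y2 y34; rewrite /outward ltNge ltW //= gt_eqF // y34. Qed.

Lemma outward_corner y : 3 / 4 <= y < 7 / 8 ->
  outward y = [:: (true, false); (false, true); (true, true)].
Proof.
case/andP=> y34 y78; have y2 : 1 / 2 < y by lra.
by rewrite /outward ltNge ltW //= gt_eqF // ltNge y34 /= y78.
Qed.

Lemma outward_right y : 7 / 8 <= y -> outward y = [:: (false, true);
  (true, true)].
Proof.
move=> y78; have y2 : 1 / 2 < y by lra.
have y34 : 3 / 4 <= y by lra.
by rewrite /outward ltNge ltW //= gt_eqF // ltNge y34 /= ltNge y78.
Qed.

Lemma outward_root : outward (1 / 2 : R) = [:: (false, false); (false, true)].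
Proof. by rewrite /outward ltxx eqxx. Qed.

Lemma branches_lower y : y < 1 / 2 -> branches y = [:: (false, false)].
Proof. by move=> yI; rewrite /branches outward_lower. Qed.

Lemma branches_middle y : 1 / 2 < y < 3 / 4 ->
  branches y = [:: (false, false); (true, false); (false, true)].
Proof. by move=> yI; rewrite /branches outward_middle. Qed.

Lemma branches_corner y : 3 / 4 <= y < 7 / 8 ->
  branches y = [:: (true, false); (false, true)].
Proof. by move=> yI; rewrite /branches outward_corner. Qed.

Lemma branches_right y : 7 / 8 <= y -> branches y = [:: (false, true)].
Proof. by move=> yI; rewrite /branches outward_right. Qed.

Lemma branches_root : branches (1 / 2 : R) = [:: (false, false); (false, true)].
Proof. by rewrite /branches outward_root. Qed.

Lemma descendants_outward_lower n y : 0 < y < 1 / 2 ->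
  descendants outward n y = 1%N.
Proof.
elim: n y => [|n IH] y //= y01; rewrite outward_lower ?big_seq1; last by lra.
by rewrite IH // /act x0_lower; lra.
Qed.

Lemma descendants_branches_lower n y : 0 < y < 1 / 2 ->
  descendants branches n y = 1%N.
Proof.
elim: n y => [|n IH] y //= y01; rewrite branches_lower ?big_seq1; last by lra.
by rewrite IH // /act x0_lower; lra.
Qed.

(** Covers both the entry into [7/8, 1) from [3/4, 7/8) and the steps inside it. *)
Lemma act_right i y : 3 / 4 <= y < 1 -> 7 / 8 <= act (i, true) y < 1.
Proof. by move=> yI; case: i; rewrite /act ?x1inv_upper ?x0inv_upper; lra. Qed.

Lemma descendants_outward_right n y : 7 / 8 <= y < 1 ->
  descendants outward n y = (2 ^ n)%N.
Proof.
elim: n y => [|n IH] y //= y78; rewrite outward_right; last by lra.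
have yR : 3 / 4 <= y < 1 by lra.
by rewrite !(big_cons, big_nil) !IH ?act_right // expnS; lia.
Qed.

Lemma descendants_branches_right n y : 7 / 8 <= y < 1 ->
  descendants branches n y = 1%N.
Proof.
elim: n y => [|n IH] y //= y78; rewrite branches_right; last by lra.
by rewrite big_seq1 IH // act_right //; lra.
Qed.

Lemma act_middle y : 1 / 2 < y < 3 / 4 -> 1 / 2 < act (true, false) y < 3 / 4.
Proof. by move=> yI; rewrite /act x1_lower; lra. Qed.

Lemma act_middle_up y : 1 / 2 < y < 3 / 4 ->
  3 / 4 <= act (false, true) y < 7 / 8.
Proof. by move=> yI; rewrite /act x0inv_upper; lra. Qed.

Lemma act_corner y : 3 / 4 <= y < 7 / 8 -> 1 / 2 < act (true, false) y < 3 / 4.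
Proof. by move=> yI; rewrite /act x1_middle; lra. Qed.

Lemma act_root : 3 / 4 <= act (false, true) (1 / 2 : R) < 7 / 8.
Proof. by rewrite /act x0inv_upper; lra. Qed.

(** With M and C the counts in (1/2, 3/4) and [3/4, 7/8), the recurrences are M' = 1 + M + C and C'
    = M + 2 * 2^n; both are solved by 2^(n+1) - 1. *)
Lemma descendants_outward_middle n :
  (forall y, 1 / 2 < y < 3 / 4 -> (descendants outward n y).+1 =
    (2 ^ n.+1)%N) /\
  (forall y, 3 / 4 <= y < 7 / 8 -> (descendants outward n y).+1 = (2 ^ n.+1)%N).
Proof.
elim: n => [//|n [IHm IHc]]; split=> y yI /=.
  rewrite outward_middle // !(big_cons, big_nil) descendants_outward_lower;
    last first.
    by rewrite /act x0_middle; lra.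
  have /IHm := act_middle yI; have /IHc := act_middle_up yI.
  by rewrite addn0 !expnS; lia.
rewrite outward_corner // !(big_cons, big_nil).
have yR : 3 / 4 <= y < 1 by lra.
rewrite !(descendants_outward_right _ (act_right _ yR)).
by have /IHm := act_corner yI; rewrite !expnS; lia.
Qed.

(** Now M' = 1 + M + C and C' = M + 1. The additive constants absorb the contributions 1 of the two
    extreme regions, leaving the Fibonacci recurrence. *)
Lemma descendants_branches_middle n :
  (forall y, 1 / 2 < y < 3 / 4 -> (descendants branches n y + 2)%N =
    fib n.+4) /\
  (forall y, 3 / 4 <= y < 7 / 8 -> (descendants branches n y + 1)%N = fib n.+3).
Proof.
elim: n => [//|n [IHm IHc]]; split=> y yI /=.
  rewrite branches_middle // !(big_cons, big_nil).
  rewrite descendants_branches_lower; last by rewrite /act x0_middle; lra.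
  have /IHm := act_middle yI; have /IHc := act_middle_up yI.
  by rewrite !fibSS; lia.
rewrite branches_corner // !(big_cons, big_nil).
have yR : 3 / 4 <= y < 1 by lra.
rewrite (descendants_branches_right _ (act_right false yR)).
by have /IHm := act_corner yI; rewrite !fibSS; lia.
Qed.

Lemma geodesic_growth_pow n : geodesic_growth (1 / 2 : R) n = (2 ^ n)%N.
Proof.
rewrite geodesic_growthE size_words; case: n => [//|n] /=.
rewrite outward_root !(big_cons, big_nil) descendants_outward_lower.
  by have [_ /(_ _ act_root)] := descendants_outward_middle n; lia.
by rewrite /act x0_lower; lra.
Qed.

Lemma sphere_size_fib n : sphere_size (1 / 2 : R) n = fib n.+2.
Proof.
rewrite sphere_sizeE size_map size_words; case: n => [//|n] /=.
rewrite branches_root !(big_cons, big_nil) descendants_branches_lower.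
  by have [_ /(_ _ act_root)] := descendants_branches_middle n; rewrite !fibSS;
    lia.
by rewrite /act x0_lower; lra.
Qed.

End Counting.

(** * Generating functions *)

Section PowerSeries.
Context {R : comNzRingType}.
Implicit Types a b : fps R.

Lemma fps_mulX a n : (a * fpsX R) n = if n is m.+1 then a m else 0.
Proof.
rewrite -[LHS]/(fps_mul a (fpsX R) n) /fps_mul /fpsX.
case: n => [|n]; first by rewrite big_ord1 mulr0.
(* The last two terms of the Cauchy product are split off: the final one meets the zero constant
   term of z, and the one before it meets the coefficient 1. *)
rewrite big_ord_recr /= subnn mulr0 addr0 big_ord_recr /= subSnn mulr1.
rewrite big1 ?add0r // => i _; rewrite (_ : (_ == _) = false) ?mulr0 //.
by have := ltn_ord i; lia.
Qed.

Lemma fps_addE a b n : (a + b) n = a n + b n. Proof. by []. Qed.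

Lemma fps_oppE a n : (- a) n = - a n. Proof. by []. Qed.

Lemma fps1E n : (1 : fps R) n = (n == 0%N)%:R. Proof. by []. Qed.

Lemma fpsXE n : fpsX R n = (n == 1%N)%:R. Proof. by []. Qed.

(** The explicit inverse [d] certifies that [b] is a unit, so that the quotient is a true one. *)
Lemma fps_divE a b c d : d * b = 1 -> c * b = a -> c = a / b.
Proof.
move=> db <-; have b_unit : b \is a GRing.unit by apply/unitrPr; exists d;
  rewrite mulrC.
by rewrite mulrK.
Qed.

Lemma genfun_pow2 : genfun R (fun n => 2 ^ n)%N = 1 / (1 - 2 * fpsX R).
Proof.
set g := genfun _ _; suff gE : g * (1 - 2 * fpsX R) =
  1 by exact: (fps_divE gE gE).
rewrite mulrBr mulr1 mulrA; apply/funext => n;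
  rewrite fps_addE fps_oppE fps_mulX fps1E.
case: n => [|n]; first by rewrite /g /genfun subr0.
rewrite mulr_natr mulr2n fps_addE /g /genfun expnS natrM mulr_natl mulr2n.
by rewrite subrr.
Qed.

Lemma genfun_fib :
  genfun R (fun n => fib n.+2) = (1 + fpsX R) / (1 - fpsX R - fpsX R ^+ 2).
Proof.
have mulE a n : (a * (1 - fpsX R - fpsX R ^+ 2)) n =
    a n - (if n is m.+1 then a m else 0) - (if n is m.+2 then a m else 0).
  rewrite !mulrBr mulr1 expr2 mulrA !fps_addE !fps_oppE !fps_mulX.
  by case: n => [|[|n]] //; rewrite fps_mulX.
(* The inverse of 1 - z - z^2 is the series of the Fibonacci numbers from F_1 on; both products are
   checked coefficientwise. *)
apply: (@fps_divE _ _ _ (genfun R (fun n => fib n.+1))); apply/funext => n;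
  rewrite mulE ?fps_addE ?fps1E ?fpsXE /genfun;
  case: n => [|[|n]].
- by rewrite !subr0.
- by rewrite subr0 subrr.
- by rewrite [fib n.+3]fibSS natrD /=; ring.
- by rewrite !subr0 addr0.
- by rewrite subr0 [fib 3]fibSS natrD addrAC subrr.
- by rewrite [fib n.+4]fibSS natrD /=; ring.
Qed.

End PowerSeries.

Lemma binet (R : realType) n : (fib n)%:R =
  (((1 + Num.sqrt 5) / 2) ^+ n - ((1 - Num.sqrt 5) / 2) ^+ n) / Num.sqrt 5 :> R.
Proof.
have s5 : Num.sqrt 5 * Num.sqrt 5 = 5 :> R by rewrite -expr2 sqr_sqrtr.
have s0 : Num.sqrt 5 != 0 :> R by rewrite gt_eqF ?sqrtr_gt0.
(* Two consecutive indices are carried for the two-step recurrence, with the denominator cleared. *)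
suff [] : (fib n)%:R * Num.sqrt 5 =
    ((1 + Num.sqrt 5) / 2) ^+ n - ((1 - Num.sqrt 5) / 2) ^+ n :> R /\
  (fib n.+1)%:R * Num.sqrt 5 =
    ((1 + Num.sqrt 5) / 2) ^+ n.+1 - ((1 - Num.sqrt 5) / 2) ^+ n.+1 :> R.
  by move=> <- _; rewrite mulfK.
elim: n => [|n [IH0 IH1]]; first by split; rewrite /fib ?mul0r ?expr1 ?expr0;
  field.
have recE (x : R) : x * x = x + 1 -> x ^+ n.+2 = x ^+ n.+1 + x ^+ n.
  by move=> xx; rewrite !exprS mulrA xx mulrDl mul1r.
split=> //; rewrite fibSS natrD mulrDl IH0 IH1 !recE; [ring|nra|nra].
Qed.

Theorem mainTheorem3 (R : realType) :
  let p : R := 1 / 2 in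
  let phi : R := (1 + Num.sqrt 5) / 2 in
  let phih : R := (1 - Num.sqrt 5) / 2 in
  let z : fps R := fpsX R in
  [/\ genfun R (geodesic_growth p) = 1 / (1 - 2 * z),
      genfun R (sphere_size p) = (1 + z) / (1 - z - z ^+ 2) &
      forall n : nat,
        (sphere_size p n)%:R = (phi ^+ (n + 2) - phih ^+ (n + 2)) / Num.sqrt 5
        /\
        (ball_size p n)%:R =
          (phi ^+ (n + 3) - phi ^+ 2) / (Num.sqrt 5 * (phi - 1))
          - (phih ^+ (n + 3) - phih ^+ 2) / (Num.sqrt 5 * (phih - 1))].
Proof.
move=> p phi phih z; split.
- rewrite -genfun_pow2; congr genfun; apply/funext => n.
  exact: geodesic_growth_pow.
- rewrite -genfun_fib; congr genfun; apply/funext => n.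
  exact: sphere_size_fib.
have sphereE n : (sphere_size p n)%:R =
    (phi ^+ (n + 2) - phih ^+ (n + 2)) / Num.sqrt 5 :> R.
  by rewrite sphere_size_fib binet addn2.
move=> n; split=> //; rewrite ball_sizeE.
have s5 : 1 < Num.sqrt 5 :> R.
  by rewrite -[X in X < _]sqrtr1 ltr_sqrt // ltr1n.
have s0 : Num.sqrt 5 != 0 :> R by lra.
have phi1 : phi - 1 != 0 by rewrite /phi; lra.
have phih1 : phih - 1 != 0 by rewrite /phih; lra.
(* The closed form is a difference of two geometric sums, so each step is a rational identity once
   [phi] and [phih] are known to differ from 1. *)
elim: n => [|n IH].
  by rewrite big_ord1 sphereE add0n !exprS !expr0; field; rewrite s0 phi1 phih1.
rewrite big_ord_recr natrD IH sphereE !addSn !addnS !addn0 !exprS.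
by field; rewrite s0 phi1 phih1.
Qed.
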